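(* Let $0<\alpha\le 1$ and $\cos^{-1}(\alpha/2)\le\theta<\pi$. Then $$ C^L(\alpha,\theta)\le \frac{v_+(\alpha,\theta)}{2\sqrt{\alpha\sin\theta}}\;C^L\!\left(1,\frac{\pi}{2}\right), \qquad\text{where } v_+(\alpha,\theta)=1+\alpha^2+\sqrt{1+2\alpha^2\cos 2\theta+\alpha^4}. $$
   Context: For $0<\alpha\le 1$ and $\cos^{-1}(\alpha/2)\le\theta<\pi$, $K_{\alpha,\theta}$ denotes the (closed) triangle with vertices $p_1=(0,0)$, $p_2=(1,0)$, $p_3=(\alpha\cos\theta,\alpha\sin\theta)$. For a triangle $K$ and $u\in H^2(K)$ (so $u$ is continuous on $K$), the linear Lagrange interpolant $\Pi^L u$ is the affine function on $K$ agreeing with $u$ at the three vertices of $K$. $\|\cdot\|_{\infty,K}$ is the $L^\infty(K)$-norm and $|u|_{2,K}$ is the $H^2$-seminorm, $|u|_{2,K}^2=\int_K (u_{xx}^2+u_{xy}^2+u_{yx}^2+u_{yy}^2)\,dK$. The optimal interpolation error constant is $$C^L(\alpha,\theta):=\sup_{u\in H^2(K_{\alpha,\theta}),\ |u|_{2,K_{\alpha,\theta}}\ne 0}\frac{\|u-\Pi^L u\|_{\infty,K_{\alpha,\theta}}}{|u|_{2,K_{\alpha,\theta}}},$$ i.e. the smallest constant $C$ with $\|u-\Pi^Lu\|_{\infty,K_{\alpha,\theta}}\le C|u|_{2,K_{\alpha,\theta}}$ for all $u\in H^2(K_{\alpha,\theta})$. *)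

(* Defs.v *)
From HB Require Import structures.
From mathcomp Require Import all_boot all_order all_algebra.
From mathcomp Require Import all_classical all_reals all_analysis.
From mathcomp Require Import ring.

Set Implicit Arguments.
Unset Strict Implicit.
Unset Printing Implicit Defensive.

Import Order.TTheory GRing.Theory Num.Theory.
Import numFieldNormedType.Exports.

Local Open Scope classical_set_scope.
Local Open Scope ring_scope.

Definition lebesgue2 (R : realType) :
    {measure set (measurableTypeR R * measurableTypeR R) -> \bar R} :=
  ((@lebesgue_measure R) \x (@lebesgue_measure R))%E.

(* The vertices p_1, p_2, p_3 of K_{alpha,theta}, indexed from 0. *)
Definition vertex (R : realType) (alpha theta : R) (i : 'I_3) : R * R :=
  nth (0, 0) [:: (0, 0); (1, 0); (alpha * cos theta, alpha * sin theta)] i.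

Definition triangle (R : realType) (alpha theta : R) : set (R * R) :=
  [set p | exists c : 'I_3 -> R,
     [/\ forall i, 0 <= c i, \sum_i c i = 1 &
         p = \sum_i c i *: vertex alpha theta i]].

Variant axis := X | Y.

Definition unit_vector (R : realType) (i : axis) : R * R :=
  if i is X then (1, 0) else (0, 1).

(* Iterated partial derivatives; the multi-index is the list of the
   directions of differentiation. *)
Definition partial (R : realType) (s : seq axis) (f : R * R -> R) :
    R * R -> R :=
  foldr (fun i g p => 'D_(unit_vector R i) g p) f s.

(* C^oo functions whose support is a compact subset of the interior of K. *)
Definition test_function (R : realType) (K : set (R * R)) (phi : R * R -> R) :=
  (forall s, continuous (partial s phi) /\
     forall i p, derivable (partial s phi) p (unit_vector R i)) /\
  exists2 S : set (R * R), compact S /\ S `<=` K° &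
    forall p, ~ S p -> phi p = 0.

Definition weak_partial (R : realType) (K : set (R * R)) (s : seq axis)
    (u g : R * R -> R) :=
  forall phi, test_function K phi ->
    \int[lebesgue2 R]_(p in K) (u p * partial s phi p) =
    (-1) ^+ size s * \int[lebesgue2 R]_(p in K) (g p * phi p).

(* An element of H^2(K) is given by its continuous representative together
   with square-integrable representatives of its weak partial derivatives of
   order at most 2. The latter are unique up to null sets, so that nothing
   below depends on their choice. All values outside K are irrelevant, and so
   is [H2d u s] when [2 < size s]. *)
Record H2 (R : realType) (K : set (R * R)) := {
  H2fun :> R * R -> R ;
  H2d : seq axis -> R * R -> R ;
  H2_continuous : {within K, continuous H2fun} ;
  H2_L2 : H2fun \_ K \in Lfun (lebesgue2 R) 2%:E ;
  H2d_L2 : forall s, (size s <= 2)%N ->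
    H2d s \_ K \in Lfun (lebesgue2 R) 2%:E ;
  H2d_weak : forall s, (size s <= 2)%N -> weak_partial K s H2fun (H2d s) }.

Definition H2_seminorm (R : realType) (K : set (R * R)) (u : H2 K) : R :=
  Num.sqrt (\int[lebesgue2 R]_(p in K)
    (H2d u [:: X; X] p ^+ 2 + H2d u [:: X; Y] p ^+ 2 +
     H2d u [:: Y; X] p ^+ 2 + H2d u [:: Y; Y] p ^+ 2)).

Definition Linfty_norm (R : realType) (K : set (R * R)) (f : R * R -> R) :
    \bar R :=
  'N[lebesgue2 R]_+oo [EFin \o (f \_ K)]%E.

Definition affine_map (R : realType) (f : R * R -> R) :=
  exists a b c : R, f = fun p => a * p.1 + b * p.2 + c.

Definition is_lagrange (R : realType) (alpha theta : R) (u f : R * R -> R) :=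
  affine_map f /\
  forall i, f (vertex alpha theta i) = u (vertex alpha theta i).

Definition lagrange_interp (R : realType) (alpha theta : R) (u : R * R -> R) :
    R * R -> R :=
  get (is_lagrange alpha theta u).

Lemma lagrangeP (R : realType) (alpha theta : R) (u : R * R -> R) :
  alpha * sin theta != 0 ->
  is_lagrange alpha theta u (lagrange_interp alpha theta u).
Proof.
move=> h; apply: getPex; pose v i := u (vertex alpha theta i).
pose a := v 1 - v 0.
pose b := (v 2%:R - v 0 - a * (alpha * cos theta)) / (alpha * sin theta).
exists (fun p => a * p.1 + b * p.2 + v 0); split; first by exists a, b, (v 0).
case=> -[|[|[|//]]] lti; rewrite [in LHS]/vertex/=.
- rewrite !mulr0 !add0r /v; congr (u (vertex _ _ _)); exact: val_inj.
- have -> : a * 1 + b * 0 + v 0 = v 1 by rewrite /a; ring.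
  by congr (u (vertex _ _ _)); apply: val_inj.
- have -> : a * (alpha * cos theta) + b * (alpha * sin theta) + v 0 = v 2%:R.
    by rewrite /b divfK//; ring.
  by congr (u (vertex _ _ _)); apply: val_inj.
Qed.

Lemma lagrange_uniq (R : realType) (alpha theta : R) (u f g : R * R -> R) :
  alpha * sin theta != 0 ->
  is_lagrange alpha theta u f -> is_lagrange alpha theta u g -> f = g.
Proof.
move=> h [[a [b [c ->]]] fu] [[a' [b' [c' ->]]] gu].
have e i : _ = _ := etrans (fu i) (esym (gu i)).
move: (e (@Ordinal 3 0 isT)) (e (@Ordinal 3 1 isT)) (e (@Ordinal 3 2 isT)).
rewrite /vertex/= !mulr0 !mulr1 !add0r !addr0 => cc'; rewrite cc'.
move=> /addIr aa'; rewrite aa' => /addIr /addrI /(mulIf h) bb'.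
by rewrite bb'.
Qed.

Definition interp_ratio (R : realType) (alpha theta : R)
    (u : H2 (triangle alpha theta)) : \bar R :=
  (Linfty_norm (triangle alpha theta) (u \- lagrange_interp alpha theta u)%R *
   ((H2_seminorm u)^-1)%:E)%E.

(* The supremum is taken in the extended reals. *)
Definition CL (R : realType) (alpha theta : R) : \bar R :=
  ereal_sup [set interp_ratio u | u in
    [set u : H2 (triangle alpha theta) | H2_seminorm u != 0]].

Definition v_plus (R : realType) (alpha theta : R) : R :=
  1 + alpha ^+ 2 +
  Num.sqrt (1 + 2 * alpha ^+ 2 * cos (2 * theta) + alpha ^+ 4).

(* Main.v *)
Require Import Defs.
From mathcomp Require Import all_boot all_order all_algebra.
From mathcomp Require Import all_classical all_reals all_analysis.
From mathcomp Require Import measurable_realfun ess_sup_inf.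
From mathcomp Require Import ring lra.
Set Implicit Arguments.
Unset Strict Implicit.
Unset Printing Implicit Defensive.
Import Order.TTheory GRing.Theory Num.Theory.
Import numFieldNormedType.Exports.
Local Open Scope classical_set_scope.
Local Open Scope ring_scope.

(** Let [c = alpha cos theta] and [d = alpha sin theta > 0]. The linear map
[shear c d], [(x, y) |-> (x + c y, d y)], sends the reference triangle
[triangle 1 (pi / 2)] onto [triangle alpha theta], vertex to vertex
([triangle_shear]). The theorem comes from comparing the interpolation ratio of
[u] with that of [v = u \o shear c d]:

- The numerators agree: composing with an affine map commutes with Lagrange
  interpolation, and an invertible linear map preserves null sets, hence
  essential suprema ([lagrange_interp_shear], [Linfty_norm_shear]).

- For the denominators, write [M] for the matrix of the map and [H] for the
  Hessian of [u]. The Hessian of [v] is [M^T H M] taken at the image point, so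
  its Frobenius norm is at most [l] times that of [H], where [l] is the largest
  eigenvalue of [M M^T]. That eigenvalue is [v_plus alpha theta / 2]
  ([v_plus_spec]). Integrating, and accounting for the Jacobian [d], gives
  [H2_seminorm v <= l / sqrt d * H2_seminorm u] ([H2_seminorm_shear]). The same
  estimate for the inverse map shows that the seminorm of [v] does not vanish
  when that of [u] does not, so [v] competes in the supremum defining
  [CL 1 (pi / 2)].

Most of the work is to see that [v] is an element of H^2 of the reference
triangle, with the expected weak derivatives ([H2_shear]). A weak derivative is
tested against smooth functions, so this reduces to the linear change of
variables in plane integrals ([lebesgue2_shear] and its consequences) together
with the chain rule for iterated partial derivatives of smooth functions
([partial_shear]). The chain rule in turn rests on the fact that continuous
partial derivatives determine all directional derivatives
([is_derive_partial]). *)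

(** * Linear change of variables in the plane *)

Section measure_change.
Context {R : realType}.

Lemma lebesgue_measure_affine (a b : R) (A : set R) :
  0 < a -> measurable A ->
  lebesgue_measure A =
  (a%:E * lebesgue_measure ((fun x : R => a * x + b)%R @^-1` A))%E.
Proof.
move=> a0 mA.
rewrite -[RHS]/(pushforward (mscale (NngNum (ltW a0)) (@lebesgue_measure R))
  (fun x : measurableTypeR R => a * x + b : measurableTypeR R) A).
have mf : measurable_fun setT
    (fun x : measurableTypeR R => a * x + b : measurableTypeR R).
  by apply: measurable_funD => //; exact: measurable_funM.
apply: lebesgue_measure_unique => //= _ [[x y]] _ <-.
rewrite /pushforward /mscale/=.
have -> : (fun z => a * z + b) @^-1` `]x, y] =
    `](x - b) / a, (y - b) / a]%classic.
  apply/seteqP; split => z /=; rewrite !in_itv/= ltr_pdivrMr// ler_pdivlMr//;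
    by rewrite ltrBlDr lerBrDr mulrC.
rewrite !lebesgue_measure_itv/= !lte_fin ltr_pM2r ?invr_gt0// ltrD2r.
case: ifPn; rewrite ?mule0// => _.
by rewrite -!EFinD -EFinM; congr EFin; field; rewrite gt_eqF.
Qed.

Definition shear (c d : R) (p : R * R) : R * R := (p.1 + c * p.2, d * p.2).

Lemma shearK (c d : R) : d != 0 ->
  cancel (shear c d) (shear (- c / d) d^-1).
Proof. by move=> d0 [x y]; rewrite /shear/=; congr pair; field. Qed.

Lemma shearVK (c d : R) : d != 0 ->
  cancel (shear (- c / d) d^-1) (shear c d).
Proof. by move=> d0 [x y]; rewrite /shear/=; congr pair; field. Qed.

Lemma measurable_shear (c d : R) :
  measurable_fun setT
   (shear c d : measurableTypeR R * measurableTypeR R ->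
                measurableTypeR R * measurableTypeR R).
Proof.
apply/measurable_fun_pairP; split => /=.
  by apply: measurable_funD => //=; exact: measurable_funM.
exact: measurable_funM.
Qed.

(** Both iterated integrals of an indicator agree. Slicing along the second
coordinate is the form in which a shear, which translates each horizontal
slice, is easy to handle. *)
Lemma lebesgue2E (S : set (R * R)) : measurable S ->
  lebesgue2 R S =
  (\int[@lebesgue_measure R]_y lebesgue_measure (ysection S y))%E.
Proof.
move=> mS.
rewrite -[RHS]/((@lebesgue_measure R \x^ @lebesgue_measure R)%E S).
by apply: product_measure_unique => // A B mA mB; exact: product_measure2E.
Qed.

(** The horizontal slice of the preimage at height [y] is a translate of the
slice of [S] at height [d * y]; the factor [d] is that of the dilation of
heights. *)
Lemma lebesgue2_shear (c d : R) (S : set (R * R)) : 0 < d ->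
  measurable S ->
  lebesgue2 R S = (d%:E * lebesgue2 R (shear c d @^-1` S))%E.
Proof.
move=> d0 mS.
have mLS : measurable (shear c d @^-1` S).
  by rewrite -[X in measurable X]setTI; exact: measurable_shear.
rewrite !lebesgue2E//.
pose g y := lebesgue_measure (ysection S y).
have mg : measurable_fun setT g by exact: measurable_fun_ysection.
have gL y : lebesgue_measure (ysection (shear c d @^-1` S) y) = g (d * y).
  rewrite /g (@lebesgue_measure_affine 1 (c * y) (ysection S _))//; last first.
    exact: measurable_ysection.
  rewrite mul1e; congr lebesgue_measure; apply/seteqP.
  by split => x /=; rewrite /ysection /preimage/= !in_setE /= /shear /= mul1r.
under [in RHS]eq_integral do rewrite gL.
rewrite -(@ge0_integral_mscale _ _ _ lebesgue_measure _ _
  (NngNum (ltW d0)) (fun y => g (d * y)%R))//; last first.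
  exact: (measurableT_comp mg (measurable_funM _ _)).
rewrite -[setT](@preimage_setT _ _ ( *%R d)).
rewrite -[RHS](@ge0_integral_pushforward _ _
  (measurableTypeR R) (measurableTypeR R) _ ( *%R d) _ _ setT g)//.
  apply: eq_measure_integral => /= A mA _.
  rewrite (@lebesgue_measure_affine d 0)//.
  by rewrite /pushforward /mscale/=; under eq_fun do rewrite addr0.
Qed.

Local Notation plane := (measurableTypeR R * measurableTypeR R)%type.
Local Notation mu := (lebesgue2 R).

Lemma ge0_integral_shear (c d : R) (f : plane -> \bar R) : 0 < d ->
  measurable_fun setT f -> (forall p, 0 <= f p)%E ->
  (\int[mu]_p f p = d%:E * \int[mu]_p f (shear c d p))%E.
Proof.
move=> d0 mf f0; have mL := @measurable_shear c d.
rewrite -(@ge0_integral_mscale _ _ _ mu _ _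
  (NngNum (ltW d0)) (f \o shear c d))//; last 2 first.
- exact: (measurableT_comp mf mL).
- by move=> p _; exact: f0.
rewrite -[X in (\int[mscale _ _]_(x in X) _)%E](@preimage_setT _ _ (shear c d)).
rewrite -[RHS](@ge0_integral_pushforward _ _ plane plane _ (shear c d) mL
  (mscale (NngNum (ltW d0)) mu) setT f)//.
by apply: eq_measure_integral => /= A mA _; rewrite (lebesgue2_shear c d0).
Qed.

Lemma integrable_shear (c d : R) (f : plane -> \bar R) : 0 < d ->
  mu.-integrable setT f -> mu.-integrable setT (f \o shear c d).
Proof.
move=> d0 /integrableP[mf fo]; have mL := @measurable_shear c d.
apply/integrableP; split; first exact: (measurableT_comp mf mL).
move: fo; rewrite (@ge0_integral_shear c d)//; last exact: measurableT_comp.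
move=> h; rewrite ltNge leye_eq; apply/negP => /eqP/= E.
by move: h; rewrite E gt0_muley.
Qed.

Lemma integral_shear (c d : R) (f : plane -> \bar R) : 0 < d ->
  mu.-integrable setT f ->
  (\int[mu]_p f p = d%:E * \int[mu]_p f (shear c d p))%E.
Proof.
move=> d0 fi; have /integrableP[mf _] := fi.
have fE : (\int[mu]_p f (shear c d p) = \int[mu]_p f^\+ (shear c d p)
    - \int[mu]_p f^\- (shear c d p))%E.
  rewrite -[LHS]/(\int[mu]_p (f \o shear c d) p)%E integralE.
  by rewrite funepos_comp funeneg_comp.
rewrite fE integralE.
rewrite (@ge0_integral_shear c d (f^\+)%E)//; last exact: measurable_funepos.
rewrite (@ge0_integral_shear c d (f^\-)%E)//; last exact: measurable_funeneg.
rewrite [RHS]muleBr//; apply: fin_num_adde_defl; rewrite fin_numN.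
have := integrable_funeneg measurableT (integrable_shear c d0 fi).
rewrite funeneg_comp => fni; exact: (integrable_fin_num measurableT fni).
Qed.

Lemma restrict_shear (c d : R) (K : set (R * R)) (f : R * R -> R) :
  (f \_ K) \o shear c d = (f \o shear c d) \_ (shear c d @^-1` K).
Proof.
by apply/funext => p; rewrite /patch/= /preimage; congr (if _ then _ else _);
  rewrite /mem /= /in_mem/= /in_set /=.
Qed.

Lemma Rintegral_shear (c d : R) (K : set (R * R)) (f : R * R -> R) : 0 < d ->
  mu.-integrable setT (EFin \o (f \_ K)) ->
  \int[mu]_(p in K) f p =
  d * \int[mu]_(p in shear c d @^-1` K) f (shear c d p).
Proof.
move=> d0 fi; rewrite Rintegral_mkcond [in RHS]Rintegral_mkcond.
rewrite -[X in _ = _ * Rintegral _ _ X](restrict_shear c d K f).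
rewrite /Rintegral (integral_shear c d0 fi) fineM//.
exact: (integrable_fin_num measurableT (integrable_shear c d0 fi)).
Qed.

Lemma Lfun_shear (c d : R) (f : R * R -> R) : 0 < d ->
  f \in Lfun mu 2%:E -> f \o shear c d \in Lfun mu 2%:E.
Proof.
move=> d0; rewrite !inE => /andP[]; rewrite !inE /= => mf.
have mL := @measurable_shear c d.
rewrite /finite_norm unlock/= => fo; apply/andP; split; rewrite !inE/=.
  exact: (measurableT_comp mf mL).
rewrite /finite_norm unlock/=; apply: poweR_lty.
have {}fo : (\int[mu]_x (`|f x| `^ 2)%:E < +oo)%E.
  by apply: (@lty_poweRy _ _ 2^-1).
move: fo; rewrite (@ge0_integral_shear c d)//; last first.
  apply/measurable_EFinP.
  apply: (measurableT_comp (f := fun x : R => x `^ 2)) => //.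
  exact: measurableT_comp.
move=> h; rewrite ltNge leye_eq; apply/negP => /eqP/= E.
by move: h; rewrite E gt0_muley.
Qed.

Lemma ae_shear (c d : R) (P : set (R * R)) : 0 < d ->
  {ae mu, forall p, P p} -> {ae mu, forall p, P (shear c d p)}.
Proof.
move=> d0 [A [mA A0 sA]]; exists (shear c d @^-1` A); split.
- by rewrite -[X in measurable X]setTI; exact: measurable_shear.
- move: A0; rewrite (lebesgue2_shear c d0 mA) => /eqP.
  by rewrite mule_eq0 eqe gt_eqF//= => /eqP.
- by move=> p /= np; exact: sA.
Qed.

(** Applied to the inverse map as well, this yields the equality of the two
essential suprema. *)
Lemma ess_sup_shear (c d : R) (f : R * R -> \bar R) : 0 < d ->
  (ess_sup mu (f \o shear c d) <= ess_sup mu f)%E.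
Proof.
move=> d0; apply/ess_supP.
exact: (ae_shear c d0 (P := fun p => f p <= ess_sup mu f)%E (ess_sup_ge mu f)).
Qed.

(** The measurable structure on the plane is the product one, so an open set has
to be exhibited as a countable union of measurable rectangles: squares with
rational centre and side [2 / (n + 1)]. *)
Lemma open_measurable_plane (U : set (R * R)) : open U ->
  measurable (U : set plane).
Proof.
move=> oU.
pose B (n : nat) (a b : rat) : set (R * R) :=
  ball (ratr a : R) n.+1%:R^-1 `*` ball (ratr b : R) n.+1%:R^-1.
have -> : U = \bigcup_n \bigcup_a \bigcup_b
    (if `[< B n a b `<=` U >] then B n a b else set0).
  apply/seteqP; split => [[x y] Uxy|p [n _ [a _ [b _]]]]; last first.
    by case: asboolP => // + Bp; apply.
  have /nbhs_ballP[e /= e0 eU] : nbhs (x, y) U by exact: open_nbhs_nbhs.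
  have [n ne] : exists n, n.+1%:R^-1 < e / 2 :> R.
    have [n _ ne] := near_infty_natSinv_lt (PosNum (divr_gt0 e0 (ltr0n _ 2))).
    by exists n; exact: (ne n (leqnn _)).
  have n0 : 0 < n.+1%:R^-1 :> R by rewrite invr_gt0.
  set r := n.+1%:R^-1 in ne n0.
  have rat_near (z : R) : exists a : rat, ball (ratr a : R) r z.
    have /rat_in_itvoo[a] : z - r < z + r by lra.
    rewrite in_itv/= => /andP[h1 h2]; exists a.
    by rewrite -ball_normE/= ltr_distlC; apply/andP; split; lra.
  have [a xa] := rat_near x; have [b yb] := rat_near y.
  exists n => //; exists a => //; exists b => //.
  case: asboolP => [//|[]] -[x' y']; rewrite /B -/r => -[/= xa' yb'].
  apply: eU; split => /=.
    apply: (@le_ball _ _ _ (r + r)); first lra.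
    exact: (ball_triangle (ball_sym xa) xa').
  apply: (@le_ball _ _ _ (r + r)); first lra.
  exact: (ball_triangle (ball_sym yb) yb').
apply: bigcupT_measurable => n; apply: bigcupT_measurable_rat => a.
apply: bigcupT_measurable_rat => b; case: ifPn => // _.
by apply: measurableX; exact: measurable_ball.
Qed.

Lemma continuous_measurable_plane (f : R * R -> R) : continuous f ->
  measurable_fun setT (f : plane -> R).
Proof.
move=> /continuousP cf; apply: (measurability _ (RGenOpens.measurableE R)).
move=> _ [_ [a [b ->] <-]]; rewrite setTI; apply: open_measurable_plane.
exact/cf/interval_open.
Qed.

End measure_change.

(** * Directional derivatives from partial derivatives *)

Section calculus.
Context {R : realType}.
Implicit Types (f g : R * R -> R) (p q v : R * R).

Lemma scale_pair (h : R) v : h *: v = (h * v.1, h * v.2).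
Proof. by case: v. Qed.

Lemma add_pair p q : p + q = (p.1 + q.1, p.2 + q.2).
Proof. by case: p q => ? ? []. Qed.

Lemma is_derive_line f q v (t : R) : derivable f (t *: v + q) v ->
  is_derive t 1 (fun s : R => f (s *: v + q)) ('D_v f (t *: v + q)).
Proof.
move=> dv; have e : (fun h : R => h^-1 *:
    (((fun s : R => f (s *: v + q)) \o shift t) (h *: 1) - f (t *: v + q))) =
    (fun h : R => h^-1 *: ((f \o shift (t *: v + q)) (h *: v) - f (t *: v + q))).
  apply/funext => h /=; congr (_ *: (f _ - _)).
  by rewrite addrA -scalerDl /GRing.scale/= mulr1.
by apply: DeriveDef; rewrite /derivable /derive e.
Qed.

Lemma directional_MVT f q v (h : R) : (forall p, derivable f p v) ->
  exists2 t, `|t| <= `|h| & f (h *: v + q) - f q = h * 'D_v f (t *: v + q).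
Proof.
move=> dv; pose g (s : R) := f (s *: v + q).
have dg (t : R) : is_derive t 1 g ('D_v f (t *: v + q)) by exact: is_derive_line.
have cg : continuous g.
  move=> t; apply: differentiable_continuous; apply/derivable1_diffP.
  by have [] := dg t.
have g0 : g 0 = f q by rewrite /g scale0r add0r.
have [h0|h0] := leP 0 h.
  have [t] := MVT_segment h0 (fun x _ => dg x) (continuous_subspaceT cg).
  rewrite in_itv/= => /andP[t0 th] e; exists t; first by rewrite !ger0_norm.
  by rewrite -g0 -/(g h) e subr0 mulrC.
have [t] := MVT_segment (ltW h0) (fun x _ => dg x) (continuous_subspaceT cg).
rewrite in_itv/= => /andP[th t0] e; exists t.
  by rewrite !ler0_norm ?lerN2// ltW.
by rewrite -g0 -/(g h) -opprB e sub0r mulrN opprK mulrC.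
Qed.

(** The increment along [h *: v] splits into a horizontal step followed, at [p],
by a vertical one. The mean value theorem turns each step into a partial
derivative at a nearby point, and continuity lets these points tend to [p]. *)
Lemma is_derive_partial f p v :
  (forall i q, derivable f q (unit_vector R i)) ->
  (forall i, continuous (fun q => 'D_(unit_vector R i) f q)) ->
  is_derive p v f
    (v.1 * 'D_(unit_vector R X) f p + v.2 * 'D_(unit_vector R Y) f p).
Proof.
move=> df cf; set L := (X in is_derive _ _ _ X).
suff H : (fun h : R => h^-1 *: ((f \o shift p) (h *: v) - f p)) @ 0^' --> L.
  by apply: DeriveDef; [apply/cvg_ex; exists L|exact/cvg_lim].
apply/cvgrPdist_le => /= e e0.
(* The summand [1] makes [M] positive even for [v = 0], and larger than either
   coordinate of [v]. *)
pose M := `|v.1| + `|v.2| + 1.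
have M0 : 0 < M by rewrite /M; have := normr_ge0 v.1; have := normr_ge0 v.2; lra.
have eM0 : 0 < e / M by rewrite divr_gt0.
have near_p i : exists2 r, 0 < r & forall q, ball p r q ->
    `|'D_(unit_vector R i) f p - 'D_(unit_vector R i) f q| <= e / M.
  have /cvgrPdist_le/(_ _ eM0)/nbhs_ballP[r r0 rP] := cf i p.
  by exists r => // q /rP.
have [r1 r10 r1P] := near_p X; have [r2 r20 r2P] := near_p Y.
have r0 : 0 < Num.min r1 r2 / M by rewrite divr_gt0// lt_min r10.
near=> h.
have h0 : h != 0 by near: h; exact: nbhs_dnbhs_neq.
have hM : `|h| * M < Num.min r1 r2.
  by rewrite -ltr_pdivlMr//; near: h; apply: dnbhs0_lt.
have [hMr1 hMr2] : `|h| * M < r1 /\ `|h| * M < r2.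
  by move: hM; rewrite lt_min => /andP[].
have hv1 : `|h * v.1| < `|h| * M.
  rewrite normrM ltr_pM2l ?normr_gt0// /M.
  by have := normr_ge0 v.2; lra.
have hv2 : `|h * v.2| < `|h| * M.
  rewrite normrM ltr_pM2l ?normr_gt0// /M.
  by have := normr_ge0 v.1; lra.
pose q := (p.1, p.2 + h * v.2).
have [t1 t1h E1] := directional_MVT q (h * v.1) (df X).
have [t2 t2h E2] := directional_MVT p (h * v.2) (df Y).
have b1 : ball p r1 (t1 *: unit_vector R X + q).
  rewrite scale_pair add_pair; split; rewrite -ball_normE/= ?mulr1 ?mulr0.
    by rewrite opprD addrCA subrr addr0 normrN; lra.
  by rewrite add0r opprD addrA subrr add0r normrN; lra.
have b2 : ball p r2 (t2 *: unit_vector R Y + p).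
  rewrite scale_pair add_pair; split; rewrite -ball_normE/= ?mulr1 ?mulr0.
    rewrite add0r subrr normr0; apply: le_lt_trans hMr2.
    by rewrite mulr_ge0// ltW.
  by rewrite opprD addrCA subrr addr0 normrN; lra.
have e1 : (h * v.1) *: unit_vector R X + q = h *: v + p.
  by rewrite /q !scale_pair !add_pair/= mulr1 mulr0 add0r [_ + p.2]addrC.
have e2 : (h * v.2) *: unit_vector R Y + p = q.
  by rewrite /q !scale_pair !add_pair/= mulr1 mulr0 add0r [_ + p.2]addrC.
have -> : h^-1 *: ((f \o shift p) (h *: v) - f p) =
    v.1 * 'D_(unit_vector R X) f (t1 *: unit_vector R X + q) +
    v.2 * 'D_(unit_vector R Y) f (t2 *: unit_vector R Y + p).
  rewrite e2 in E2; rewrite /= -e1 -[X in X - _](subrK (f q)) E1 -addrA E2.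
  by rewrite /GRing.scale/=; field.
have := r1P _ b1; have := r2P _ b2; rewrite /L.
move: ('D_(unit_vector R X) f p) ('D_(unit_vector R Y) f p) => B A.
move: ('D_(unit_vector R X) f _) ('D_(unit_vector R Y) f _) => B' A' h1 h2.
have -> : v.1 * B + v.2 * A - (v.1 * B' + v.2 * A') =
    v.1 * (B - B') + v.2 * (A - A') by ring.
rewrite (le_trans (ler_normD _ _))// !normrM.
have -> : e = `|v.1| * (e / M) + `|v.2| * (e / M) + e / M.
  rewrite -mulrDl -[X in _ + X]mul1r -mulrDl -/M; field.
  by rewrite gt_eqF.
rewrite -[leLHS]addr0 lerD ?(ltW eM0)// lerD// ler_wpM2l//.
Unshelve. all: by end_near. Qed.

End calculus.

(** * Iterated derivatives after a linear change of variables *)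

Section smooth_functions.
Context {R : realType}.
Implicit Types (f g : R * R -> R) (p q v : R * R).

(** The regularity clause of [test_function], separated from the condition on
the support. *)
Definition smooth f := forall s, continuous (partial s f) /\
  forall i p, derivable (partial s f) p (unit_vector R i).

Lemma partial_cat s t f : partial (s ++ t) f = partial s (partial t f).
Proof. exact: foldr_cat. Qed.

Lemma smooth_partial s f : smooth f -> smooth (partial s f).
Proof. by move=> sf t; rewrite -partial_cat; exact: sf. Qed.

Lemma smooth_lincomb (a b : R) f g : smooth f -> smooth g ->
  smooth (fun p => a * f p + b * g p).
Proof.
move=> sf sg.
have E s : partial s (fun p => a * f p + b * g p) =
    (fun p => a * partial s f p + b * partial s g p).
  elim: s => //= i s ->; apply/funext => p.
  rewrite -[X in 'D__ X _]/(a \*: partial s f \+ b \*: partial s g).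
  have [_ df] := sf s; have [_ dg] := sg s.
  by rewrite deriveD ?deriveZ//; exact: derivableZ.
move=> s; rewrite {}E; have [cf df] := sf s; have [cg dg] := sg s; split.
  move=> p; apply: cvgD; apply: cvgM;
    by [exact: cvg_cst|exact: cf|exact: cg].
by move=> i p; apply: derivableD; exact: derivableZ.
Qed.

Lemma derive_shear (c d : R) f p v :
  'D_v (f \o shear c d) p = 'D_(shear c d v) f (shear c d p) /\
  (derivable f (shear c d p) (shear c d v) -> derivable (f \o shear c d) p v).
Proof.
suff e : (fun h : R => h^-1 *:
      (((f \o shear c d) \o shift p) (h *: v) - (f \o shear c d) p)) =
    (fun h : R => h^-1 *:
      ((f \o shift (shear c d p)) (h *: shear c d v) - f (shear c d p))).
  by rewrite /derive /derivable e.
apply/funext => h /=; congr (_ *: (f _ - _)); case: v p => [a b] [x y].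
by rewrite /shear/=; congr pair; rewrite /= /GRing.scale/=; ring.
Qed.

(** If [D] is the family of iterated derivatives of [f], then [pull c d D s] is
the derivative of [f \o shear c d] along [s], before composition with
[shear c d]: the chain rule replaces the direction [X] by [X] and the direction
[Y] by [c X + d Y]. On multi-indices of length two this is [H |-> M^T H M] for
the matrix [M] of [shear c d]. Being linear in [D], it applies to classical and
to weak derivatives alike. *)
Fixpoint pull (c d : R) (D : seq axis -> R * R -> R) (s : seq axis) :
    R * R -> R :=
  match s with
  | [::] => D [::]
  | X :: s => pull c d (fun t => D (X :: t)) s
  | Y :: s => fun p => c * pull c d (fun t => D (X :: t)) s p +
                       d * pull c d (fun t => D (Y :: t)) s p
  end.

Lemma smooth_pull (c d : R) s (D : seq axis -> R * R -> R) :
  (forall t, smooth (D t)) -> smooth (pull c d D s).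
Proof.
elim: s D => [|[] s IHs] D sD //=; first exact: IHs.
by apply: smooth_lincomb; exact: IHs.
Qed.

(** The coefficients in [pull] are constants, so differentiation passes through
it. For the iterated derivatives of one function, this is the step that adds an
outermost direction to the multi-index. *)
Lemma derive_pull (c d : R) i s (D : seq axis -> R * R -> R) p :
  (forall t, smooth (D t)) ->
  'D_(unit_vector R i) (pull c d D s) p =
  pull c d (fun t => partial [:: i] (D t)) s p.
Proof.
elim: s D => [|[] s IHs] D sD //=; first by rewrite IHs.
rewrite -!IHs//.
have dp j : derivable (pull c d (fun t => D (j :: t)) s) p (unit_vector R i).
  exact: (smooth_pull c d s (fun t => sD (j :: t)) [::]).2.
rewrite -[X in 'D__ X _]/(c \*: pull c d (fun t => D (X :: t)) s \+
                          d \*: pull c d (fun t => D (Y :: t)) s).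
by rewrite deriveD ?deriveZ//; exact: derivableZ.
Qed.

(** Each differentiation is one application of [is_derive_partial], in the
direction [shear c d] of a unit vector. *)
Lemma partial_shear (c d : R) s f : smooth f ->
  partial s (f \o shear c d) = pull c d (fun t => partial t f) s \o shear c d /\
  forall i p, derivable (partial s (f \o shear c d)) p (unit_vector R i).
Proof.
move=> sf.
have sp t : smooth (partial t f) by exact: smooth_partial.
have key g i p : smooth g -> derivable (g \o shear c d) p (unit_vector R i) /\
   'D_(unit_vector R i) (g \o shear c d) p =
   (if i is X then 'D_(unit_vector R X) g (shear c d p) else
    c * 'D_(unit_vector R X) g (shear c d p) +
    d * 'D_(unit_vector R Y) g (shear c d p)).
  move=> sg; have [-> dd] := derive_shear c d g p (unit_vector R i).
  have [dv ev] := @is_derive_partial R g (shear c d p)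
    (shear c d (unit_vector R i)) (sg [::]).2 (fun j => (sg [:: j]).1).
  split; first exact: dd.
  rewrite ev; case: i {dd dv ev}; rewrite /shear/=; ring.
have E : partial s (f \o shear c d) =
    pull c d (fun t => partial t f) s \o shear c d.
  elim: s => //= i s ->; apply/funext => p.
  have [_ ->] := key _ i p (smooth_pull c d s sp).
  have eD j := derive_pull c d j s (shear c d p) sp.
  by move: (eD X) (eD Y) => /= eX eY; case: i; rewrite /= ?eX ?eY.
by split => // i p; rewrite E; apply: (key _ _ _ (smooth_pull c d s sp)).1.
Qed.

Lemma continuous_shear (c d : R) : continuous (shear c d).
Proof.
move=> p.
have cf : (fun q : R * R => q.1) @ p --> p.1 by exact: cvg_fst.
have cs : (fun q : R * R => q.2) @ p --> p.2 by exact: cvg_snd.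
have c1 : (fun q : R * R => q.1 + c * q.2) @ p --> p.1 + c * p.2.
  by apply: cvgD => //; apply: cvgM => //; exact: cvg_cst.
have c2 : (fun q : R * R => d * q.2) @ p --> d * p.2.
  by apply: cvgM => //; exact: cvg_cst.
exact: cvg_pair c1 c2.
Qed.

Lemma smooth_shear (c d : R) f : smooth f -> smooth (f \o shear c d).
Proof.
move=> sf s; have [E dE] := partial_shear c d s sf; split => //.
rewrite E => p; apply: continuous_comp; first exact: continuous_shear.
by apply: (smooth_pull c d s (fun t => smooth_partial t sf) [::]).1.
Qed.

End smooth_functions.

(** * Transport of Sobolev functions *)

Section transport.
Context {R : realType}.
Implicit Types (f g u w : R * R -> R) (p q v : R * R) (K : set (R * R)).
Local Notation mu := (lebesgue2 R).

Lemma test_function_shear (c d : R) K f : d != 0 ->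
  test_function K f ->
  test_function (shear c d @^-1` K) (f \o shear c d).
Proof.
move=> d0 [sf [S [cS SK] fS]]; split; first exact: smooth_shear.
exists (shear c d @^-1` S); last by move=> p Sp; exact: fS.
split => [|p Sp]; last first.
  exact: (@continuous_shear R c d p _ (SK _ Sp)).
have -> : shear c d @^-1` S = shear (- c / d) d^-1 @` S.
  apply/seteqP; split => [p Sp|_ [p Sp <-]]; last by rewrite /preimage/= shearVK.
  by exists (shear c d p) => //; rewrite shearK.
apply: continuous_compact => //; apply: continuous_subspaceT.
exact: continuous_shear.
Qed.

Lemma pull_restrict (c d : R) K (D : seq axis -> R * R -> R) s :
  (pull c d D s) \_ K = pull c d (fun t => D t \_ K) s.
Proof.
elim: s D => [//|[] s IHs] D /=; first by rewrite IHs.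
rewrite -!IHs; apply/funext => p; rewrite /patch.
by case: ifP => //; rewrite !mulr0 addr0.
Qed.

Lemma Lfun_pull (c d : R) (D : seq axis -> R * R -> R) s :
  (forall t, size t = size s -> D t \in Lfun mu 2%:E) ->
  pull c d D s \in Lfun mu 2%:E.
Proof.
elim: s D => [|[] s IHs] D hD /=; first exact: hD.
  by apply: IHs => t ts; apply: hD => /=; rewrite ts.
have hX := IHs (fun t => D (X :: t))
  (fun t ts => hD (X :: t) (congr1 succn ts)).
have hY := IHs (fun t => D (Y :: t))
  (fun t ts => hD (Y :: t) (congr1 succn ts)).
have p1 : (1 <= 2%:E :> \bar R)%E by rewrite lee_fin ler1n.
have -> : (fun p => c * pull c d (fun t => D (X :: t)) s p +
           d * pull c d (fun t => D (Y :: t)) s p) =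
  c *: (pull c d (fun t => D (X :: t)) s) +
  d *: (pull c d (fun t => D (Y :: t)) s) by [].
have cl := Lfun_submod_closed mu p1.
apply: (cl.2) => //.
by rewrite -[_ *: _]addr0; apply: (cl.2) => //; exact: cl.1.
Qed.

(** Integration by parts against one multi-index at a time extends to the
combinations formed by [pull], because both sides use the same coefficients.
Integrability is carried along, as it is what allows the integrals to be
split. *)
Lemma Rintegral_pull (c d e : R) w f (P D : seq axis -> R * R -> R) s :
  (forall t, size t = size s ->
    [/\ mu.-integrable setT (EFin \o (fun p => w p * P t p)),
        mu.-integrable setT (EFin \o (fun p => D t p * f p)) &
        \int[mu]_p (w p * P t p) = e * \int[mu]_p (D t p * f p)]) ->
    [/\ mu.-integrable setT (EFin \o (fun p => w p * pull c d P s p)),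
        mu.-integrable setT (EFin \o (fun p => pull c d D s p * f p)) &
        \int[mu]_p (w p * pull c d P s p) =
        e * \int[mu]_p (pull c d D s p * f p)].
Proof.
elim: s P D => [|[] s IHs] P D h /=; first exact: h.
  by apply: IHs => t ts; apply: h; rewrite /= ts.
have [iPX iDX eX] := IHs (fun t => P (X :: t)) (fun t => D (X :: t))
  (fun t ts => h (X :: t) (congr1 succn ts)).
have [iPY iDY eY] := IHs (fun t => P (Y :: t)) (fun t => D (Y :: t))
  (fun t ts => h (Y :: t) (congr1 succn ts)).
move: (pull c d (fun t => P (X :: t)) s) (pull c d (fun t => D (X :: t)) s)
  (pull c d (fun t => P (Y :: t)) s) (pull c d (fun t => D (Y :: t)) s)
  iPX iDX eX iPY iDY eY => PX DX PY DY iPX iDX eX iPY iDY eY.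
have -> : (fun p => w p * (c * PX p + d * PY p)) =
    (fun p => c * (w p * PX p) + d * (w p * PY p)).
  by apply/funext => p; ring.
have -> : (fun p => (c * DX p + d * DY p) * f p) =
    (fun p => c * (DX p * f p) + d * (DY p * f p)).
  by apply/funext => p; ring.
have iZ (a : R) g : mu.-integrable setT (EFin \o g) ->
    mu.-integrable setT (EFin \o (fun p => a * g p)).
  by move=> ig; exact: (integrableZl measurableT a ig).
split; [exact: (integrableD measurableT (iZ c _ iPX) (iZ d _ iPY))|
        exact: (integrableD measurableT (iZ c _ iDX) (iZ d _ iDY))|].
rewrite !RintegralD ?RintegralZl//; try exact: iZ.
by rewrite eX eY; ring.
Qed.

Definition box (M : R) : set (R * R) := `[- M, M] `*` `[- M, M].

(** On the square, [g] is bounded by some [C], and [|u| <= 1 + u ^ 2] is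
integrable since the square has finite measure. *)
Lemma integrable_L2_continuous (M : R) K u g : K `<=` box M ->
  u \_ K \in Lfun mu 2%:E -> continuous g ->
  mu.-integrable setT (EFin \o (fun p => (u \_ K) p * g p)).
Proof.
move=> KM u2 cg.
have cB : compact (box M) by apply: compact_setX; exact: segment_compact.
have [N [_ gN]] : bounded_set (g @` box M).
  apply: compact_bounded; apply: continuous_compact => //.
  exact: continuous_subspaceT.
pose C := Num.max 0 N + 1.
have C0 : 0 <= C by rewrite /C addr_ge0// le_max lexx.
have gC p : box M p -> `|g p| <= C.
  by move=> Bp; apply: gN; [rewrite /C ltr_pwDr// le_max lexx orbT|exists p].
have mB : measurable (box M : set (measurableTypeR R * measurableTypeR R)).
  by apply: measurableX; exact: measurable_itv.
have iB : mu.-integrable setT (EFin \o (\1_(box M) : R * R -> R)).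
  apply/integrableP; split; first exact/measurable_EFinP/measurable_indic.
  rewrite (_ : (fun x => _) = (fun p => (\1_(box M) p)%:E)); last first.
    by apply/funext => p /=; rewrite ger0_norm.
  rewrite integral_indic// setIT.
  have -> : mu (box M) = (lebesgue_measure `[(- M)%R, M]%classic *
      lebesgue_measure `[(- M)%R, M]%classic)%E.
    by apply: product_measure1E; exact: measurable_itv.
  by rewrite lebesgue_measure_itv; case: ifPn; rewrite ?mul0e// -EFinM ltry.
have i2 := Lfun2_integrable_sqr u2.
have mu_ : measurable_fun setT
    (u \_ K : measurableTypeR R * measurableTypeR R -> R).
  by move: u2; rewrite inE => /andP[]; rewrite inE.
apply: (@le_integrable _ _ _ mu setT measurableT _
  (EFin \o (fun p => C * (\1_(box M) p + (u \_ K) p ^+ 2)))) => //.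
- apply/measurable_EFinP; apply: measurable_funM => //.
  exact: continuous_measurable_plane.
- move=> p _ /=; rewrite lee_fin [leRHS]ger0_norm; last first.
    by rewrite mulr_ge0// addr_ge0// sqr_ge0.
  rewrite normrM /patch; case: ifPn => [|_]; last first.
    by rewrite normr0 mul0r mulr_ge0// addr_ge0// sqr_ge0.
  rewrite inE => /KM Bp; rewrite indicE mem_set//= mulrC.
  rewrite ler_pM ?gC// -(real_normK (num_real (u p))).
  by move: (`|u p|) (normr_ge0 (u p)) => a a0; nra.
- exact: (integrableZl measurableT C (integrableD measurableT iB i2)).
Qed.

(** Pull the test function back by the inverse map to get a test function on
[K], and transport both integrals to [K]; the Jacobian [d] appears on both sides
and cancels. *)
Lemma weak_partial_shear (c d M : R) K u (D : seq axis -> R * R -> R) s :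
  0 < d -> K `<=` box M -> u \_ K \in Lfun mu 2%:E ->
  (forall t, size t = size s -> D t \_ K \in Lfun mu 2%:E) ->
  (forall t, size t = size s -> weak_partial K t u (D t)) ->
  weak_partial (shear c d @^-1` K) s (u \o shear c d)
    (pull c d D s \o shear c d).
Proof.
move=> d0 KM u2 D2 uD phi tphi; have d_neq0 : d != 0 by rewrite gt_eqF.
pose psi := phi \o shear (- c / d) d^-1.
have tpsi : test_function K psi.
  have := @test_function_shear (- c / d) d^-1 _ _ (invr_neq0 d_neq0) tphi.
  rewrite -comp_preimage (_ : shear c d \o _ = id) ?preimage_id//.
  by apply/funext => p; exact: shearVK.
have -> : phi = psi \o shear c d by apply/funext => p; rewrite /psi/= shearK.
have spsi : smooth psi := tpsi.1.
have patchM f g : (fun p => f p * g p) \_ K = (fun p => (f \_ K) p * g p).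
  by apply/funext => p; rewrite /patch; case: ifP; rewrite ?mul0r.
have [|iP iD e] := @Rintegral_pull c d ((-1) ^+ size s) (u \_ K) psi
  (fun t => partial t psi) (fun t => D t \_ K) s.
  move=> t ts; split.
  - by apply: (integrable_L2_continuous KM u2); exact: (spsi t).1.
  - by apply: (integrable_L2_continuous KM (D2 t ts)); exact: (spsi [::]).1.
  - by rewrite -!patchM -!Rintegral_mkcond -ts; exact: uD.
have [-> _] := partial_shear c d s spsi.
rewrite -pull_restrict -!patchM in iP iD e.
rewrite -!Rintegral_mkcond in e.
rewrite (Rintegral_shear c d0 iP) (Rintegral_shear c d0 iD) mulrCA in e.
exact: (mulfI d_neq0 e).
Qed.

Lemma within_continuous_shear (c d : R) K u : {within K, continuous u} ->
  {within shear c d @^-1` K, continuous (u \o shear c d)}.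
Proof.
move=> /subspace_continuousP cu; apply/subspace_continuousP => p Kp.
apply: cvg_comp (cu _ Kp) => A /= wA.
exact: (@continuous_shear R c d p _ wA).
Qed.

(** The domain [K'] is kept apart from the preimage it equals so that the lemma
produces an element of [H2 K'] on the nose, without transport along the
equality. *)
Lemma H2_shear (c d M : R) K K' (u : H2 K) : 0 < d -> K `<=` box M ->
  K' = shear c d @^-1` K ->
  exists v : H2 K', H2fun v = u \o shear c d /\
    H2d v = fun s => pull c d (H2d u) s \o shear c d.
Proof.
move=> d0 KM ->.
have cv : {within shear c d @^-1` K, continuous (u \o shear c d)}.
  by apply: within_continuous_shear; exact: H2_continuous.
have v2 : (u \o shear c d) \_ (shear c d @^-1` K) \in Lfun mu 2%:E.
  by rewrite -restrict_shear; apply: Lfun_shear => //; exact: H2_L2.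
have dv2 s : (size s <= 2)%N ->
    (pull c d (H2d u) s \o shear c d) \_ (shear c d @^-1` K) \in Lfun mu 2%:E.
  move=> s2; rewrite -restrict_shear; apply: Lfun_shear => //.
  by rewrite pull_restrict; apply: Lfun_pull => t ts; apply: H2d_L2; rewrite ts.
have wv s : (size s <= 2)%N -> weak_partial (shear c d @^-1` K) s
    (u \o shear c d) (pull c d (H2d u) s \o shear c d).
  move=> s2; apply: (weak_partial_shear d0 KM); first exact: H2_L2.
    by move=> t ts; apply: H2d_L2; rewrite ts.
  by move=> t ts; apply: H2d_weak; rewrite ts.
by exists (Build_H2 cv v2 dv2 wv).
Qed.

End transport.

(** * Comparison of the seminorms *)

Section hessian.
Context {R : realType}.
Implicit Types (K : set (R * R)) (D : seq axis -> R * R -> R).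
Local Notation mu := (lebesgue2 R).

Definition hessian2 D (p : R * R) : R :=
  D [:: X; X] p ^+ 2 + D [:: X; Y] p ^+ 2 +
  D [:: Y; X] p ^+ 2 + D [:: Y; Y] p ^+ 2.

(** The left-hand side is [|M^T (x, y)|^2] for the matrix [M] of [shear c d]. The
hypotheses say that [l - M M^T] has nonnegative diagonal and determinant, hence
is positive semidefinite, that is, [l] bounds the eigenvalues of [M M^T]. *)
Lemma sqr_norm_shearT_le (c d l x y : R) :
  1 + c ^+ 2 <= l -> d ^+ 2 <= l ->
  c ^+ 2 * d ^+ 2 <= (l - 1 - c ^+ 2) * (l - d ^+ 2) ->
  x ^+ 2 + (c * x + d * y) ^+ 2 <= l * (x ^+ 2 + y ^+ 2).
Proof.
move=> l1 l2 h; pose A := l - 1 - c ^+ 2; pose B := l - d ^+ 2.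
have A0 : 0 <= A by rewrite /A; lra.
have B0 : 0 <= B by rewrite /B subr_ge0.
suff : 0 <= A * x ^+ 2 - 2 * (c * d * (x * y)) + B * y ^+ 2.
  rewrite /A /B => H; rewrite -subr_ge0; apply: le_trans H _.
  by rewrite le_eqVlt; apply/orP; left; apply/eqP; ring.
have AB : (c * d) ^+ 2 <= A * B by rewrite exprMn.
have [A_eq0|A_neq0] := eqVneq A 0.
  have /eqP : (c * d) ^+ 2 = 0.
    by apply/eqP; rewrite eq_le sqr_ge0 andbT (le_trans AB)// A_eq0 mul0r.
  rewrite sqrf_eq0 => /eqP ->; rewrite A_eq0 !mul0r mulr0 subr0 add0r.
  by rewrite mulr_ge0// sqr_ge0.
have A_gt0 : 0 < A by rewrite lt_neqAle eq_sym A_neq0.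
rewrite -(pmulr_rge0 _ A_gt0).
have -> : A * (A * x ^+ 2 - 2 * (c * d * (x * y)) + B * y ^+ 2) =
  (A * x - c * d * y) ^+ 2 + (A * B - (c * d) ^+ 2) * y ^+ 2 by ring.
by rewrite addr_ge0 ?sqr_ge0// mulr_ge0 ?sqr_ge0// subr_ge0.
Qed.

(** This is [|M^T H M|^2 <= l^2 |H|^2] for the Frobenius norm, where [H] need not
be symmetric: [M^T] acts first on the rows of [H], giving [H M], then on the
columns of the result, and each action costs a factor [l]. *)
Lemma hessian2_pull_le (c d l : R) D p :
  1 + c ^+ 2 <= l -> d ^+ 2 <= l ->
  c ^+ 2 * d ^+ 2 <= (l - 1 - c ^+ 2) * (l - d ^+ 2) ->
  hessian2 (pull c d D) p <= l ^+ 2 * hessian2 D p.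
Proof.
move=> l1 l2 h; rewrite /hessian2/=.
set a := D _ p; set b := D _ p; set a' := D _ p; set b' := D _ p.
have l0 : 0 <= l by rewrite (le_trans _ l2)// sqr_ge0.
have hr := @sqr_norm_shearT_le c d l a b l1 l2 h.
have hr' := @sqr_norm_shearT_le c d l a' b' l1 l2 h.
have hc := @sqr_norm_shearT_le c d l a a' l1 l2 h.
have hc' :=
  @sqr_norm_shearT_le c d l (c * a + d * b) (c * a' + d * b') l1 l2 h.
apply: (@le_trans _ _ (l * (a ^+ 2 + a' ^+ 2) +
    l * ((c * a + d * b) ^+ 2 + (c * a' + d * b') ^+ 2))).
  apply: le_trans (lerD hc hc').
  by rewrite le_eqVlt; apply/orP; left; apply/eqP; ring.
apply: (@le_trans _ _ (l * (l * (a ^+ 2 + b ^+ 2) + l * (a' ^+ 2 + b' ^+ 2)))).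
  rewrite -mulrDr ler_wpM2l//; apply: le_trans (lerD hr hr').
  by rewrite le_eqVlt; apply/orP; left; apply/eqP; ring.
by rewrite le_eqVlt; apply/orP; left; apply/eqP; ring.
Qed.

(** The previous bound for the inverse map, with [l] the squared Frobenius norm of
the inverse matrix instead of its sharp value: any constant serves to deduce
that [D] vanishes where [pull c d D] does. *)
Lemma hessian2_le_pull (c d : R) D p : d != 0 ->
  hessian2 D p <=
  (1 + (- c / d) ^+ 2 + d^-1 ^+ 2) ^+ 2 * hessian2 (pull c d D) p.
Proof.
move=> d0; set l := 1 + _ + _.
have := @hessian2_pull_le (- c / d) d^-1 l (pull c d D) p.
have -> : hessian2 (pull (- c / d) d^-1 (pull c d D)) p = hessian2 D p.
  by rewrite /hessian2/=; field.
apply; rewrite /l ?lerDl ?lerDr ?addr_ge0 ?sqr_ge0//.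
have := sqr_ge0 (- c / d); have := sqr_ge0 d^-1.
by move: (_ ^+ 2) (_ ^+ 2) => s t s0 t0; nra.
Qed.

Lemma integrable_hessian2 K D :
  (forall s, (size s = 2)%N -> D s \_ K \in Lfun mu 2%:E) ->
  mu.-integrable setT (EFin \o (hessian2 D \_ K)).
Proof.
move=> D2.
have i2 s : (size s = 2)%N ->
    mu.-integrable setT (EFin \o (fun p => (D s \_ K) p ^+ 2)).
  by move=> /D2; exact: Lfun2_integrable_sqr.
have -> : hessian2 D \_ K = hessian2 (fun s => D s \_ K).
  apply/funext => p; rewrite /hessian2 /patch; case: ifP => //.
  by rewrite !expr0n/= !addr0.
have [ixx ixy iyx iyy] := And4 (i2 [:: X; X] erefl) (i2 [:: X; Y] erefl)
  (i2 [:: Y; X] erefl) (i2 [:: Y; Y] erefl).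
exact: (integrableD measurableT (integrableD measurableT
  (integrableD measurableT ixx ixy) iyx) iyy).
Qed.

Lemma Rintegral_hessian2_le K D D' (a : R) : 0 <= a ->
  (forall s, (size s = 2)%N -> D s \_ K \in Lfun mu 2%:E) ->
  (forall s, (size s = 2)%N -> D' s \_ K \in Lfun mu 2%:E) ->
  (forall p, hessian2 D p <= a * hessian2 D' p) ->
  \int[mu]_(p in K) hessian2 D p <= a * \int[mu]_(p in K) hessian2 D' p.
Proof.
move=> a0 /integrable_hessian2 iD /integrable_hessian2 iD' h.
rewrite Rintegral_mkcond [in leRHS]Rintegral_mkcond -RintegralZl//.
apply: le_Rintegral => //; first exact: (integrableZl measurableT a iD').
by move=> p _; rewrite /patch; case: ifP => // _; rewrite mulr0.
Qed.

(** The Jacobian of the change of variables contributes the factor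
[1 / sqrt d]. *)
Lemma H2_seminorm_shear (c d l : R) K K' (u : H2 K) (v : H2 K') : 0 < d ->
  1 + c ^+ 2 <= l -> d ^+ 2 <= l ->
  c ^+ 2 * d ^+ 2 <= (l - 1 - c ^+ 2) * (l - d ^+ 2) ->
  K' = shear c d @^-1` K ->
  H2d v = (fun s => pull c d (H2d u) s \o shear c d) ->
  H2_seminorm v <= l / Num.sqrt d * H2_seminorm u /\
  (H2_seminorm v = 0 -> H2_seminorm u = 0).
Proof.
move=> d0 l1 l2 h eK ev.
have d_neq0 : d != 0 by rewrite gt_eqF.
have D2 s : (size s = 2)%N -> H2d u s \_ K \in Lfun mu 2%:E.
  by move=> ss; apply: H2d_L2; rewrite ss.
have pD2 s : (size s = 2)%N -> pull c d (H2d u) s \_ K \in Lfun mu 2%:E.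
  move=> ss; rewrite pull_restrict.
  by apply: Lfun_pull => t ts; apply: D2; rewrite ts.
have uE : H2_seminorm u =
  Num.sqrt (\int[mu]_(p in K) hessian2 (H2d u) p) by [].
have vE : H2_seminorm v = Num.sqrt
    (d^-1 * \int[mu]_(p in K) hessian2 (pull c d (H2d u)) p).
  rewrite (Rintegral_shear c d0 (integrable_hessian2 pD2)) mulKf//.
  by rewrite /H2_seminorm ev eK.
have l0 : 0 <= l by rewrite (le_trans _ l2)// sqr_ge0.
split.
  have -> : l / Num.sqrt d = Num.sqrt (d^-1 * l ^+ 2).
    rewrite sqrtrM ?invr_ge0 ?(ltW d0)// sqrtrV ?(ltW d0)//.
    by rewrite sqrtr_sqr ger0_norm// mulrC.
  rewrite uE vE -sqrtrM ?mulr_ge0 ?invr_ge0 ?sqr_ge0 ?(ltW d0)//.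
  rewrite ler_wsqrtr// -mulrA ler_wpM2l ?invr_ge0 ?(ltW d0)//.
  apply: Rintegral_hessian2_le => //; first exact: sqr_ge0.
  by move=> p; exact: hessian2_pull_le.
rewrite uE vE => /eqP; rewrite sqrtr_eq0 => v0; apply/eqP; rewrite sqrtr_eq0.
apply: le_trans (Rintegral_hessian2_le _ D2 pD2
  (fun p => hessian2_le_pull c _ p d_neq0)) _.
  exact: sqr_ge0.
by rewrite pmulr_rle0 ?invr_gt0// in v0; rewrite mulr_ge0_le0// sqr_ge0.
Qed.

End hessian.

(** * The triangles and their interpolants *)

Section triangles.
Context {R : realType}.
Implicit Types (alpha theta : R).

Lemma shear_sum (c d : R) (I : finType) (a : I -> R) (F : I -> R * R) :
  shear c d (\sum_i a i *: F i) = \sum_i a i *: shear c d (F i).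
Proof.
rewrite (big_morph (shear c d) (id1 := 0) (op1 := +%R)).
- apply: eq_bigr => i _; case: (F i) => x y.
  by rewrite /shear; congr pair; rewrite /= /GRing.scale/=; ring.
- by move=> [x y] [x' y']; rewrite /shear; congr pair => /=; ring.
- by rewrite /shear/= mulr0 addr0 mulr0.
Qed.

Lemma shear_vertex alpha theta i :
  shear (alpha * cos theta) (alpha * sin theta) (vertex 1 (pi / 2) i) =
  vertex alpha theta i.
Proof.
by case: i => -[|[|[|//]]] lti; rewrite /vertex/shear/= ?cos_pihalf ?sin_pihalf;
  rewrite ?mulr0 ?mulr1 ?addr0 ?add0r.
Qed.

Lemma triangle_shear alpha theta : alpha * sin theta != 0 ->
  triangle 1 (pi / 2) =
  shear (alpha * cos theta) (alpha * sin theta) @^-1` triangle alpha theta.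
Proof.
move=> d0; apply/seteqP; split => p.
  move=> [a [a0 a1 ->]]; exists a; split => //.
  by rewrite shear_sum; apply: eq_bigr => i _; rewrite shear_vertex.
move=> [a [a0 a1 e]]; exists a; split => //.
apply: (can_inj (shearK (alpha * cos theta) d0)).
by rewrite e shear_sum; apply: eq_bigr => i _; rewrite shear_vertex.
Qed.

Lemma triangle_box alpha theta :
  triangle alpha theta `<=`
    box (1 + `|alpha * cos theta| + `|alpha * sin theta|).
Proof.
move=> _ [a [a0 a1 ->]].
rewrite !big_ord_recl !big_ord0 !addr0 in a1 *.
move: (a0 ord0) (a0 (lift ord0 ord0)) (a0 (lift ord0 (lift ord0 ord0))) a1.
set x := a _; set y := a _; set z := a _ => x0 y0 z0 xyz.
rewrite /vertex/= scaler0 add0r.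
set c := alpha * cos theta; set d := alpha * sin theta.
have [z1 y1] : z <= 1 /\ y <= 1 by split; lra.
have hc : `|z * c| <= `|c| by rewrite normrM ger0_norm// ler_piMl.
have hd : `|z * d| <= `|d| by rewrite normrM ger0_norm// ler_piMl.
have := normr_ge0 c; have := normr_ge0 d.
move: hc hd; rewrite !ler_norml => /andP[c1 c2] /andP[d1 d2] ? ?.
rewrite !scale_pair !add_pair/= !mulr0 !mulr1 add0r.
by split; rewrite /= in_itv/=; apply/andP; split; lra.
Qed.

Lemma lagrange_interp_shear alpha theta (u : R * R -> R) :
  alpha * sin theta != 0 ->
  lagrange_interp 1 (pi / 2)
    (u \o shear (alpha * cos theta) (alpha * sin theta)) =
  lagrange_interp alpha theta u \o shear (alpha * cos theta) (alpha * sin theta).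
Proof.
move=> d0; have d1 : 1 * sin (pi / 2) != 0 :> R.
  by rewrite sin_pihalf mulr1 oner_neq0.
apply: (lagrange_uniq d1); first exact: lagrangeP.
have [[a [b [k ->]]] e] := lagrangeP u d0; split.
  exists a, (a * (alpha * cos theta) + b * (alpha * sin theta)), k.
  by apply/funext => p; rewrite /shear/=; ring.
by move=> i; rewrite [RHS]/= [LHS]/comp shear_vertex e.
Qed.

Lemma Linfty_norm_shear (c d : R) K f : 0 < d ->
  (Linfty_norm K f <= Linfty_norm (shear c d @^-1` K) (f \o shear c d))%E.
Proof.
move=> d0; have d_neq0 : d != 0 by rewrite gt_eqF.
rewrite /Linfty_norm -restrict_shear unlock/=; case: ifPn => // _.
have -> : abse \o (EFin \o f \_ K) =
    (abse \o (EFin \o (f \_ K \o shear c d))) \o shear (- c / d) d^-1.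
  by apply/funext => p /=; rewrite shearVK.
by apply: ess_sup_shear; rewrite invr_gt0.
Qed.

(** The matrix [M M^T] has trace [1 + c^2 + d^2 = 1 + alpha^2] and determinant
[d^2], and the radicand in [v_plus] is the discriminant of its characteristic
polynomial. Hence [v_plus alpha theta / 2] is its largest eigenvalue. *)
Lemma v_plus_spec alpha theta (c := alpha * cos theta) (d := alpha * sin theta)
    (l := v_plus alpha theta / 2) :
  [/\ 1 + c ^+ 2 <= l, d ^+ 2 <= l &
      c ^+ 2 * d ^+ 2 <= (l - 1 - c ^+ 2) * (l - d ^+ 2)].
Proof.
have cd : c ^+ 2 + d ^+ 2 = alpha ^+ 2.
  by rewrite /c /d !exprMn -mulrDr cos2Dsin2 mulr1.
(* [e] is the difference of the diagonal entries of [M M^T]. *)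
pose e := 1 + c ^+ 2 - d ^+ 2.
have DE : 1 + 2 * alpha ^+ 2 * cos (2 * theta) + alpha ^+ 4 =
    e ^+ 2 + 4 * (c ^+ 2 * d ^+ 2).
  have -> : cos (2 * theta) = cos theta ^+ 2 - sin theta ^+ 2.
    by rewrite mulr_natl mulr2n cosD -!expr2.
  have -> : alpha ^+ 4 = (c ^+ 2 + d ^+ 2) ^+ 2 by rewrite cd -exprM.
  by rewrite /e /c /d; ring.
have w0 : 0 <= 4 * (c ^+ 2 * d ^+ 2) by rewrite mulr_ge0// mulr_ge0 ?sqr_ge0.
set s := Num.sqrt (1 + 2 * alpha ^+ 2 * cos (2 * theta) + alpha ^+ 4).
have s2 : s ^+ 2 = e ^+ 2 + 4 * (c ^+ 2 * d ^+ 2).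
  by rewrite /s DE sqr_sqrtr// addr_ge0 ?sqr_ge0.
have es : `|e| <= s.
  by rewrite -sqrtr_sqr /s DE ler_wsqrtr// lerDl.
have lE : l = (1 + (c ^+ 2 + d ^+ 2) + s) / 2 by rewrite cd /l /v_plus.
move: es; rewrite ler_norml /e => /andP[es1 es2].
rewrite lE; split; [lra|lra|].
have -> : ((1 + (c ^+ 2 + d ^+ 2) + s) / 2 - 1 - c ^+ 2) *
    ((1 + (c ^+ 2 + d ^+ 2) + s) / 2 - d ^+ 2) = (s ^+ 2 - e ^+ 2) / 4.
  by rewrite /e; field.
by rewrite s2; lra.
Qed.

End triangles.

Theorem theorem2p1 (R : realType) (alpha theta : R)
    (halpha0 : 0 < alpha) (halpha1 : alpha <= 1)
    (htheta : acos (alpha / 2) <= theta) (htheta_pi : theta < pi) :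
  (CL alpha theta <=
   (v_plus alpha theta / (2 * Num.sqrt (alpha * sin theta)))%:E *
   CL 1 (pi / 2))%E.
Proof.
have th0 : 0 < theta.
  by apply: lt_le_trans htheta; apply: acos_gt0; apply/andP; split; lra.
pose d := alpha * sin theta.
have d0 : 0 < d by rewrite mulr_gt0// sin_gt0_pi// th0.
have d_neq0 : d != 0 by rewrite gt_eqF.
have [l1 l2 l3] := v_plus_spec alpha theta.
set k := v_plus _ _ / _.
have kE : k = v_plus alpha theta / 2 / Num.sqrt d by rewrite /k invfM mulrA.
have vp0 : 0 <= v_plus alpha theta / 2 by rewrite (le_trans _ l2)// sqr_ge0.
have k0 : 0 <= k by rewrite kE divr_ge0// sqrtr_ge0.
apply: ub_ereal_sup => _ [u /= u0 <-].
have [v [vE dvE]] := H2_shear u d0 (@triangle_box _ alpha theta)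
  (triangle_shear d_neq0).
have [vu v0] := H2_seminorm_shear d0 l1 l2 l3
  (triangle_shear d_neq0) dvE.
have vn0 : H2_seminorm v != 0 by apply: contra_neq u0 => /v0.
apply: (@le_trans _ _ (k%:E * interp_ratio v)%E); last first.
  by rewrite lee_wpmul2l ?lee_fin//; apply: ereal_sup_ubound; exists v.
rewrite /interp_ratio muleCA -EFinM.
rewrite lee_pmul ?Lnorm_ge0 ?lee_fin ?invr_ge0 ?sqrtr_ge0//.
  rewrite vE lagrange_interp_shear// (triangle_shear d_neq0).
  exact: Linfty_norm_shear.
have sv : 0 < H2_seminorm v by rewrite lt_neqAle eq_sym vn0 sqrtr_ge0.
have su : 0 < H2_seminorm u by rewrite lt_neqAle eq_sym u0 sqrtr_ge0.
by rewrite ler_pdivlMr// ler_pdivrMl// [_ * k]mulrC kE.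
Qed.
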